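(* Let $R$ be a ring, $M$ a right $R$-module satisfying the $D_2$ condition, and $S=\mathrm{End}_R(M)$. Then $M$ is dual $\pi$-Rickart if and only if $S$ is a $\pi$-regular ring.
   Context: Rings are associative with identity and modules are unitary right modules. $M$ is dual $\pi$-Rickart if for every $f\in S$ there exist $e^2=e\in S$ and a positive integer $n$ such that $\mathrm{Im} f^n=eM$. $M$ has the $D_2$ condition if every submodule $N$ of $M$ such that $M/N$ is isomorphic to a direct summand of $M$ is itself a direct summand of $M$. A ring $T$ is $\pi$-regular if for each $a\in T$ there exist a positive integer $n$ and $x\in T$ such that $a^n=a^nxa^n$. *)

(* Defs.v *)
From HB Require Import structures.
From mathcomp Require Import all_boot all_algebra.
From mathcomp Require Import generic_quotient ring_quotient.
From mathcomp Require Import boolp classical_sets.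

Set Implicit Arguments.
Unset Strict Implicit.
Unset Printing Implicit Defensive.

Import GRing.Theory.
Import Quotient.

Local Open Scope ring_scope.
Local Open Scope quotient_scope.
Local Open Scope classical_set_scope.

(* A right R-module is a left module over the converse ring: [lmodType R^c].
   The definitions below are one-sided and apply to [lmodType A] for any
   [A : pzRingType]; rings and modules may be zero, as [pzRingType] allows
   [1 = 0].

   Submodules are [submodClosed] predicates.  These are boolean, but by the
   classical axioms of [boolp] every subset of a type is of that form. *)

(* The product of endomorphisms is composition, [(f * g) x = f (g x)], so that
   they act on the left of elements, as is usual for right modules. *)

Section EndomorphismRing.
Variables (A : pzRingType) (M : lmodType A).

Definition endo : Type := {linear M -> M}.

HB.instance Definition _ := gen_eqMixin endo.
HB.instance Definition _ := gen_choiceMixin endo.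

Implicit Types f g h : endo.

Lemma endo_ext f g : f =1 g -> f = g.
Proof.
case: f => f [cf1 cf2]; case: g => g [cg1 cg2] /= /funext fg.
subst g; congr GRing.Linear.Pack.
by congr GRing.Linear.Class; [case: cf1 cg1 | case: cf2 cg2] => ? [?];
  congr (_ _); exact: Prop_irrelevance.
Qed.

Definition endo_zero : endo := (\0 : {linear M -> M}).
Definition endo_opp f : endo := (\- f : {linear M -> M}).
Definition endo_add f g : endo := (f \+ g : {linear M -> M}).
Definition endo_one : endo := (idfun : {linear M -> M}).
Definition endo_mul f g : endo := (f \o g : {linear M -> M}).

Lemma endo_addA : associative endo_add.
Proof. by move=> f g h; apply: endo_ext => x /=; rewrite addrA. Qed.

Lemma endo_addC : commutative endo_add.
Proof. by move=> f g; apply: endo_ext => x /=; rewrite addrC. Qed.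

Lemma endo_add0 : left_id endo_zero endo_add.
Proof. by move=> f; apply: endo_ext => x /=; rewrite add0r. Qed.

Lemma endo_addN : left_inverse endo_zero endo_opp endo_add.
Proof. by move=> f; apply: endo_ext => x /=; rewrite addNr. Qed.

HB.instance Definition _ :=
  GRing.isZmodule.Build endo endo_addA endo_addC endo_add0 endo_addN.

Lemma endo_mulA : associative endo_mul.
Proof. by move=> f g h; apply: endo_ext. Qed.

Lemma endo_mul1l : left_id endo_one endo_mul.
Proof. by move=> f; apply: endo_ext. Qed.

Lemma endo_mul1r : right_id endo_one endo_mul.
Proof. by move=> f; apply: endo_ext. Qed.

Lemma endo_mulDl : left_distributive endo_mul +%R.
Proof. by move=> f g h; apply: endo_ext. Qed.

Lemma endo_mulDr : right_distributive endo_mul +%R.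
Proof. by move=> f g h; apply: endo_ext => x /=; rewrite raddfD. Qed.

HB.instance Definition _ := GRing.Zmodule_isPzRing.Build endo
  endo_mulA endo_mul1l endo_mul1r endo_mulDl endo_mulDr.

End EndomorphismRing.

Section Submodules.
Variables (A : pzRingType) (M : lmodType A).

Definition submod (N : submodClosed M) : Type := {x : M | x \in N}.

HB.instance Definition _ N := SubType.on (submod N).
HB.instance Definition _ N := [Choice of submod N by <:].
HB.instance Definition _ N :=
  [SubChoice_isSubLmodule of submod N by <:].

(* [submodClosed] does not inherit from [zmodClosed], which [{quot _}] needs:
   closure under opposites is derived from scaling by [-1]. *)
Definition submod_zmod (N : submodClosed M) : {pred M} := N.

HB.instance Definition _ N := GRing.isZmodClosed.Build M (submod_zmod N)
  (GRing.submod_closedB (submodClosedP N)).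

Definition quotmod (N : submodClosed M) : Type := {quot (submod_zmod N)}.

HB.instance Definition _ N := GRing.Zmodule.on (quotmod N).

Section QuotientScaling.
Variable N : submodClosed M.

Definition quotmod_pi (x : M) : quotmod N := \pi_({quot (submod_zmod N)}) x.

Definition quotmod_scale (a : A) (q : quotmod N) : quotmod N :=
  quotmod_pi (a *: repr (q : {quot (submod_zmod N)})).

Lemma quotmod_piK (q : quotmod N) : quotmod_pi (repr (q : {quot (submod_zmod N)})) = q.
Proof. exact: reprK. Qed.

Lemma quotmod_piP x y : reflect (quotmod_pi x = quotmod_pi y) (x - y \in N).
Proof.
rewrite (_ : (x - y \in N) = (x - y \in submod_zmod N)) // idealrBE.
exact: eqP.
Qed.

Lemma quotmod_piD x y : quotmod_pi (x + y) = quotmod_pi x + quotmod_pi y.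
Proof. exact: raddfD. Qed.

Lemma quotmod_scale_pi a x :
  quotmod_scale a (quotmod_pi x) = quotmod_pi (a *: x).
Proof.
apply/quotmod_piP; rewrite -scalerBr rpredZ //.
by apply/quotmod_piP; rewrite quotmod_piK.
Qed.

Lemma quotmod_scaleA a b q :
  quotmod_scale a (quotmod_scale b q) = quotmod_scale (a * b) q.
Proof. by rewrite -[q]quotmod_piK !quotmod_scale_pi scalerA. Qed.

Lemma quotmod_scale1 : left_id 1 quotmod_scale.
Proof. by move=> q; rewrite -[q]quotmod_piK quotmod_scale_pi scale1r. Qed.

Lemma quotmod_scaleDr : right_distributive quotmod_scale +%R.
Proof.
move=> a p q; rewrite -[p]quotmod_piK -[q]quotmod_piK.
by rewrite -quotmod_piD !quotmod_scale_pi scalerDr quotmod_piD.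
Qed.

Lemma quotmod_scaleDl q :
  {morph quotmod_scale^~ q : a b / a + b >-> a + b}.
Proof.
move=> a b; rewrite -[q]quotmod_piK.
by rewrite !quotmod_scale_pi scalerDl quotmod_piD.
Qed.

HB.instance Definition _ := GRing.Zmodule_isLmodule.Build A (quotmod N)
  quotmod_scaleA quotmod_scale1 quotmod_scaleDr quotmod_scaleDl.

Lemma quotmod_pi_linear : linear quotmod_pi.
Proof. by move=> a x y; rewrite quotmod_piD -quotmod_scale_pi. Qed.

HB.instance Definition _ :=
  GRing.isLinear.Build A M (quotmod N) _ quotmod_pi quotmod_pi_linear.

End QuotientScaling.

Definition direct_summand (N : submodClosed M) : Prop :=
  exists K : submodClosed M,
    (forall x : M, exists y z : M, [/\ y \in N, z \in K & x = y + z]) /\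
    (forall x : M, x \in N -> x \in K -> x = 0).

End Submodules.

Definition isomorphic (A : pzRingType) (U V : lmodType A) : Prop :=
  exists phi : {linear U -> V}, bijective phi.

Definition D2_condition (A : pzRingType) (M : lmodType A) : Prop :=
  forall N D : submodClosed M,
    direct_summand D -> isomorphic (quotmod N) (submod D) -> direct_summand N.

Definition dual_pi_Rickart (A : pzRingType) (M : lmodType A) : Prop :=
  forall f : endo M, exists (e : endo M) (n : nat),
    [/\ e ^+ 2 = e, (0 < n)%N & range (f ^+ n : endo M) = range e].

Definition pi_regular (T : pzRingType) : Prop :=
  forall a : T, exists (n : nat) (x : T),
    (0 < n)%N /\ a ^+ n = a ^+ n * x * a ^+ n.

(* Main.v *)
Require Import Defs.
From HB Require Import structures.
From mathcomp Require Import all_boot all_algebra.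
From mathcomp Require Import boolp classical_sets.

(** If [f ^+ n] has image [eM], then [M / ker (f ^+ n)] is isomorphic to the
    summand [eM], so [D2] gives [M = ker (f ^+ n) (+) K].  Sending [m] to the
    unique [k] in [K] with [f ^+ n k = e m] is then a generalized inverse of
    [f ^+ n].  Conversely, if [a ^+ n = a ^+ n * x * a ^+ n], then
    [e = a ^+ n * x] is an idempotent with the same image as [a ^+ n]. *)

Set Implicit Arguments.
Unset Strict Implicit.
Unset Printing Implicit Defensive.

Import GRing.Theory.

Local Open Scope ring_scope.
Local Open Scope classical_set_scope.

Section KernelImage.
Variables (A : pzRingType) (U V : lmodType A) (g : {linear U -> V}).

Definition lin_ker : {pred U} := fun x => g x == 0.
(** Membership in the image is an existential proposition; [asbool] makes it boolean, as
    [submodClosed] requires. *)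
Definition lin_im : {pred V} := fun y => `[< range g y >].

Lemma lin_kerP x : reflect (g x = 0) (x \in lin_ker).
Proof. exact: eqP. Qed.

Lemma lin_imP y : reflect (exists x, g x = y) (y \in lin_im).
Proof.
by apply: (iffP (asboolP _)) => [[x _ <-]|[x <-]]; exists x.
Qed.

Lemma lin_ker_closed : submod_closed lin_ker.
Proof.
split=> [|a x y /lin_kerP gx /lin_kerP gy]; apply/lin_kerP; first exact: linear0.
by rewrite linearP gx gy scaler0 addr0.
Qed.

Lemma lin_im_closed : submod_closed lin_im.
Proof.
split=> [|a _ _ /lin_imP[x <-] /lin_imP[y <-]]; apply/lin_imP.
  by exists 0; rewrite linear0.
by exists (a *: x + y); rewrite linearP.
Qed.

HB.instance Definition _ := GRing.isSubmodClosed.Build A U lin_ker lin_ker_closed.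
HB.instance Definition _ := GRing.isSubmodClosed.Build A V lin_im lin_im_closed.

Lemma first_isomorphism :
  isomorphic (quotmod (lin_ker : submodClosed U)) (submod (lin_im : submodClosed V)).
Proof.
pose pi := @quotmod_pi A U (lin_ker : submodClosed U).
have pi_surj q : exists x, pi x = q by exists (repr q); exact: quotmod_piK.
have piP x y : pi x = pi y <-> g x = g y.
  split=> [/quotmod_piP/lin_kerP/eqP|gxy].
    by rewrite linearB subr_eq0 => /eqP.
  by apply/quotmod_piP; apply/lin_kerP; rewrite linearB gxy subrr.
(* Any representative [x] of [q] may be used, since [piP] makes [g x] independent of it. Quantifying
   over all representatives lets linearity be checked on [a *: x + y]. *)
have /choice[phi phiE] q : exists v : submod (lin_im : submodClosed V),
    forall x, pi x = q -> val v = g x.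
  have [x <-] := pi_surj q.
  have gx : g x \in (lin_im : submodClosed V) by apply/lin_imP; exists x.
  by exists (Sub (g x) gx) => y /piP ->.
have phi_pi x : val (phi (pi x)) = g x by exact: phiE.
have phi_lin : linear phi.
  move=> a p q; have [x <-] := pi_surj p; have [y <-] := pi_surj q.
  apply: val_inj; rewrite (phiE _ (a *: x + y)); last by rewrite /pi linearP.
  by rewrite linearP -!phi_pi.
pose phiL : {linear _ -> _} := HB.pack phi (GRing.isLinear.Build A _ _ _ phi phi_lin).
exists phiL.
have phi_inj : injective phi.
  move=> p q; have [x <-] := pi_surj p; have [y <-] := pi_surj q.
  by move=> /(congr1 val); rewrite !phi_pi => /piP.
have /choice[psi psiK] v : exists q, phi q = v.
  have /lin_imP[x gx] := valP v.
  by exists (pi x); apply: val_inj; rewrite phi_pi.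
by exists psi => // q; apply: phi_inj; rewrite psiK.
Qed.

End KernelImage.

Section GeneralizedInverse.
Variables (A : pzRingType) (M : lmodType A).
Implicit Types e f g x : endo M.

Lemma idempotentK e : e ^+ 2 = e -> forall m, e (e m) = e m.
Proof. by move=> ee m; rewrite -[in RHS]ee expr2. Qed.

(** The complement is the kernel of [e]: [m = e m + (m - e m)], and [e] fixes every element of its
    own image. *)
Lemma direct_summand_im g e :
  e ^+ 2 = e -> range g = range e ->
  direct_summand (lin_im g : submodClosed M).
Proof.
move=> /idempotentK ee gE; exists (lin_ker e : submodClosed M); split=> [m|m].
  exists (e m), (m - e m); split; last by rewrite addrC subrK.
    by apply/asboolP; rewrite gE; exists m.
  by apply/lin_kerP; rewrite linearB ee subrr.
move=> /asboolP; rewrite gE => -[m' _ <-] /lin_kerP.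
by rewrite ee.
Qed.

Lemma generalized_inverse g e :
  e ^+ 2 = e -> range g = range e ->
  direct_summand (lin_ker g : submodClosed M) ->
  exists x, g = g * x * g.
Proof.
move=> /idempotentK ee gE [K [dec cap]].
(* [K] meets the kernel of [g] only in 0. *)
have g_injK k k' : k \in K -> k' \in K -> g k = g k' -> k = k'.
  move=> Kk Kk' gkk'; apply/eqP; rewrite -subr_eq0; apply/eqP/cap.
    by apply/lin_kerP; rewrite linearB gkk' subrr.
  exact: (GRing.submod_closedB (submodClosedP K)).2.
(* Write [e m = g y] and drop the kernel component of [y]. *)
have /choice[h hP] m : exists k, k \in K /\ g k = e m.
  have : range g (e m) by rewrite gE; exists m.
  move=> [y _ <-]; have [z [k [/lin_kerP gz Kk ->]]] := dec y.
  by exists k; rewrite linearD gz add0r.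
(* [h] comes from choice, but its values are unique by [g_injK], and this forces linearity. *)
have h_lin : linear h.
  move=> a x y; have [Kx gx] := hP x; have [Ky gy] := hP y.
  have [Kxy gxy] := hP (a *: x + y).
  by apply: g_injK => //; [rewrite rpredD ?rpredZ | rewrite gxy !linearP gx gy].
pose hL : {linear M -> M} := HB.pack h (GRing.isLinear.Build A _ _ _ h h_lin).
exists hL; apply: endo_ext => m; rewrite /GRing.mul /= (hP _).2.
(* What remains is [g m = e (g m)]: [e] fixes its image, which is that of [g]. *)
have : range e (g m) by rewrite -gE; exists m.
by move=> [m' _ <-]; rewrite ee.
Qed.

Lemma dual_pi_Rickart_pi_regular :
  D2_condition M -> dual_pi_Rickart M -> pi_regular (endo M).
Proof.
move=> D2 dpR f; have [e [n [ee n_gt0 fnE]]] := dpR f.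
have [|x fnx] := generalized_inverse ee fnE; last by exists n, x.
(* [D2] is applied to the kernel of [f ^+ n], with the image of [f ^+ n] as the summand. *)
exact: D2 (direct_summand_im ee fnE) (first_isomorphism _).
Qed.

Lemma pi_regular_dual_pi_Rickart :
  pi_regular (endo M) -> dual_pi_Rickart M.
Proof.
move=> piS f; have [n [x [n_gt0 fnx]]] := piS f.
exists (f ^+ n * x), n; split=> //; first by rewrite expr2 mulrA -fnx.
(* One inclusion is clear; for the other, [f ^+ n] sends [m] to the value of [f ^+ n * x] at its own
   image of [m]. *)
apply/seteqP; split=> _ [m _ <-]; last by exists (x m).
by exists ((f ^+ n : endo M) m) => //; rewrite [in RHS]fnx.
Qed.

End GeneralizedInverse.

Theorem theorem3p11 (R : pzRingType) (M : lmodType R^c)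
  (D2 : D2_condition M) :
  dual_pi_Rickart M <-> pi_regular (endo M).
Proof.
split; first exact: dual_pi_Rickart_pi_regular.
exact: pi_regular_dual_pi_Rickart.
Qed.
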